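(* Let $(M,g)$ be a Riemannian manifold of dimension $m\ge 2$, let $a:[0,+\infty)\to(0,+\infty)$ be smooth, and let $T(M)$ be endowed with the metric $g_a$ and the almost complex structure $J_a$. If $J_a$ is integrable, then for every $u\in T(M)$ and all $X,Y\in T_{\tau(u)}M$ $$R(X,Y)u=\frac{2a-(1+\mathfrak r)a'}{2a^2\,\mathfrak r(1+\mathfrak r)}\big(g(Y,u)X-g(X,u)Y\big),$$ $M$ has constant sectional curvature $c$, and, as a function of $\mathfrak r=\sqrt{1+2t}$, $$a=\frac{e^{2\mathfrak r}}{(1+\mathfrak r)\big(c\,e^{2\mathfrak r}(\mathfrak r-1)+k(1+\mathfrak r)\big)}$$ for some positive real constant $k$, with $c\ge 0$.
   Context: $\tau:T(M)\to M$ is the tangent bundle projection. For a point $u\in T_pM$ of $T(M)$, put $t=\tfrac12 g_p(u,u)$ and $\mathfrak r=\sqrt{1+2t}$; $a$ is evaluated at $t$ and $a'=da/dt$. $R$ is the curvature tensor of $g$, $R(X,Y)Z=\nabla_X\nabla_YZ-\nabla_Y\nabla_XZ-\nabla_{[X,Y]}Z$, where $\nabla$ is the Levi-Civita connection. $X^H$ and $X^V$ denote the horizontal lift (with respect to $\nabla$) and the vertical lift to $T(M)$ of a vector (field) $X$ on $M$; $u^H,u^V$ are the lifts at $(p,u)$ of $u$ itself. The almost complex structure $J_a$ on $T(M)$ is given at $(p,u)$ by $$J_aX^H=\frac1{\sqrt{a}}\Big(X^V-\frac1{\mathfrak r(1+\mathfrak r)}g(X,u)u^V\Big),\qquad J_aX^V=-\sqrt{a}\Big(X^H+\frac1{1+\mathfrak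 r}g(X,u)u^H\Big).$$ It is compatible with the metric $g_a$ given by $g_a(X^H,Y^H)=g(X,Y)$, $g_a(X^H,Y^V)=0$, $g_a(X^V,Y^V)=a(t)\big(g(X,Y)+g(X,u)g(Y,u)\big)$. $J_a$ is integrable if its Nijenhuis tensor vanishes identically. *)

(* Defs.v *)
From mathcomp Require Import all_boot all_order all_algebra.
From mathcomp Require Import all_classical all_reals all_analysis.
From mathcomp Require Import ring lra.
Set Implicit Arguments.
Unset Strict Implicit.
Unset Printing Implicit Defensive.
Import Order.TTheory GRing.Theory Num.Theory numFieldNormedType.Exports.
Local Open Scope classical_set_scope.
Local Open Scope ring_scope.

Section Smoothness.
Context {R : realType}.

Fixpoint Ck_on {V W : normedModType R} (k : nat) (U : set V) (f : V -> W)
    : Prop :=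
  if k is k'.+1 then
    (forall x, U x -> differentiable f x) /\
    (forall v, Ck_on k' U (fun x => 'D_v f x))
  else forall x, U x -> {for x, continuous f}.

(* To be used with [U] open. *)
Definition smooth_on {V W : normedModType R} (U : set V) (f : V -> W) : Prop :=
  forall k, Ck_on k U f.

(* Functions on [0, +oo[ are represented by functions on R whose values on
   ]-oo, 0[ are never used: every difference quotient below is restricted to
   [0, +oo[, so that the derivative at 0 is the right derivative. *)
Definition ray_nbhs (t : R) : set_system R := within [set s | 0 <= s] t^'.

Definition ray_quotient (f : R -> R) (t s : R) : R := (f s - f t) / (s - t).

Definition ray_derive (f : R -> R) (t : R) : R :=
  lim (ray_quotient f t @ ray_nbhs t).

Definition ray_smooth (f : R -> R) : Prop :=
  forall k t, 0 <= t -> cvg (ray_quotient (iter k ray_derive f) t @ ray_nbhs t).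

End Smoothness.

Section VectorFields.
Context {R : realType} {V : normedModType R}.

Definition lie_bracket (X Y : V -> V) (p : V) : V :=
  'D_(X p) Y p - 'D_(Y p) X p.

(* [J p] is the endomorphism of the tangent space at [p]. *)
Definition nijenhuis (J : V -> V -> V) (X Y : V -> V) (p : V) : V :=
  let JX q := J q (X q) in
  let JY q := J q (Y q) in
  lie_bracket JX JY p - J p (lie_bracket JX Y p) - J p (lie_bracket X JY p)
  - lie_bracket X Y p.

End VectorFields.

(* An m-dimensional smooth manifold with a (not necessarily maximal) smooth
   atlas. The chart [i] is [coord i], defined on [dom i], with inverse
   [param i]; outside of the chart domains these functions are arbitrary. *)
Record smooth_manifold (R : realType) (m : nat) := SmoothManifold {
  space :> topologicalType;
  space_nonempty : [set: space] !=set0;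
  space_hausdorff : hausdorff_space space;
  space_second_countable : @second_countable space;
  chart : Type;
  dom : chart -> set space;
  coord : chart -> space -> 'rV[R]_m;
  param : chart -> 'rV[R]_m -> space;
  dom_open : forall i, open (dom i);
  dom_cover : forall p, exists i, dom i p;
  coord_open : forall i, open (coord i @` dom i);
  coordK : forall i p, dom i p -> param i (coord i p) = p;
  coord_continuous : forall i p, dom i p -> {for p, continuous (coord i)};
  param_continuous :
    forall i x, (coord i @` dom i) x -> {for x, continuous (param i)};
  transition_smooth : forall i j,
    smooth_on (coord i @` (dom i `&` dom j)) (coord j \o param i)
}.

(* A tangent vector at p is represented, in each chart i around p, by its
   components in 'rV[R]_m; the components in two charts i and j correspond
   under the differential of [transition i j] at [coord i p]. Tensor fields and
   connections are given by their components in the charts, subject to the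
   corresponding transformation laws. *)
Section Manifold.
Context {R : realType} {m : nat} (M : smooth_manifold R m).

Definition region (i : chart M) : set 'rV[R]_m := coord i @` dom i.

Definition transition (i j : chart M) : 'rV[R]_m -> 'rV[R]_m :=
  coord j \o param i.

Definition gram_form (G : 'M[R]_m) (X Y : 'rV[R]_m) : R :=
  (X *m G *m Y^T) 0 0.

Record riemannian_metric := RiemannianMetric {
  gram : chart M -> 'rV[R]_m -> 'M[R]_m;
  gram_smooth : forall i, smooth_on (region i) (gram i);
  gram_sym : forall i x, region i x -> (gram i x)^T = gram i x;
  gram_pos : forall i x, region i x ->
    forall X, X != 0 -> 0 < gram_form (gram i x) X X;
  gram_transition : forall i j p, dom i p -> dom j p -> forall X Y,
    gram_form (gram i (coord i p)) X Y =
    gram_form (gram j (coord j p))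
      ('D_X (transition i j) (coord i p)) ('D_Y (transition i j) (coord i p))
}.

(* [christoffel i x X Y] is the vector with components
   \sum_(a, b) Gamma^k_ab X^a Y^b. The last axiom is the inhomogeneous
   transformation law of the Christoffel symbols. *)
Record connection := Connection {
  christoffel : chart M -> 'rV[R]_m -> 'rV[R]_m -> 'rV[R]_m -> 'rV[R]_m;
  christoffel_smooth : forall i X Y,
    smooth_on (region i) (fun x => christoffel i x X Y);
  christoffel_linearl : forall i x, region i x -> forall (b : R) X X' Y,
    christoffel i x (b *: X + X') Y
    = b *: christoffel i x X Y + christoffel i x X' Y;
  christoffel_linearr : forall i x, region i x -> forall (b : R) X Y Y',
    christoffel i x X (b *: Y + Y')
    = b *: christoffel i x X Y + christoffel i x X Y';
  christoffel_transition : forall i j p, dom i p -> dom j p -> forall X Y,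
    'D_(christoffel i (coord i p) X Y) (transition i j) (coord i p) =
    'D_X (fun x => 'D_Y (transition i j) x) (coord i p) +
    christoffel j (coord j p)
      ('D_X (transition i j) (coord i p)) ('D_Y (transition i j) (coord i p))
}.

Variables (g : riemannian_metric) (nabla : connection).

Definition inner (i : chart M) (x : 'rV[R]_m) : 'rV[R]_m -> 'rV[R]_m -> R :=
  gram_form (gram g i x).

Definition cov (i : chart M) (X Y : 'rV[R]_m -> 'rV[R]_m) (x : 'rV[R]_m)
    : 'rV[R]_m :=
  'D_(X x) Y x + christoffel nabla i x (X x) (Y x).

Definition torsion_free : Prop :=
  forall i X Y, smooth_on (region i) X -> smooth_on (region i) Y ->
  forall x, region i x -> cov i X Y x - cov i Y X x = lie_bracket X Y x.

Definition metric_compatible : Prop :=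
  forall i X Y Z, smooth_on (region i) X -> smooth_on (region i) Y ->
    smooth_on (region i) Z ->
  forall x, region i x ->
    'D_(X x) (fun z => inner i z (Y z) (Z z)) x
    = inner i x (cov i X Y x) (Z x) + inner i x (Y x) (cov i X Z x).

Definition levi_civita : Prop := torsion_free /\ metric_compatible.

Definition curvature_field (i : chart M) (X Y Z : 'rV[R]_m -> 'rV[R]_m)
    (x : 'rV[R]_m) : 'rV[R]_m :=
  cov i X (cov i Y Z) x - cov i Y (cov i X Z) x - cov i (lie_bracket X Y) Z x.

(* The curvature tensor on vectors: since [curvature_field] is tensorial, the
   vectors may be extended to any vector fields, here to those with constant
   components in the chart. *)
Definition curvature (i : chart M) (x X Y Z : 'rV[R]_m) : 'rV[R]_m :=
  curvature_field i (cst X) (cst Y) (cst Z) x.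

Definition sectional_curvature (i : chart M) (x X Y : 'rV[R]_m) : R :=
  inner i x (curvature i x X Y Y) X /
  (inner i x X X * inner i x Y Y - inner i x X Y ^+ 2).

Definition constant_sectional_curvature (c : R) : Prop :=
  forall i x, region i x -> forall X Y, free [:: X; Y] ->
  sectional_curvature i x X Y = c.

(* The chart i of M induces the chart (x, u) of T(M), defined on
   [tregion i]: x is the base point and u the components of the vector. *)
Definition tregion (i : chart M) : set ('rV[R]_m * 'rV[R]_m) :=
  [set w | region i w.1].

Definition energy (i : chart M) (w : 'rV[R]_m * 'rV[R]_m) : R :=
  2^-1 * inner i w.1 w.2 w.2.

Definition fiber_radius (t : R) : R := Num.sqrt (1 + 2 * t).

Definition vlift (X : 'rV[R]_m) : 'rV[R]_m * 'rV[R]_m := (0, X).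

Definition hlift (i : chart M) (w : 'rV[R]_m * 'rV[R]_m) (X : 'rV[R]_m)
    : 'rV[R]_m * 'rV[R]_m :=
  (X, - christoffel nabla i w.1 X w.2).

(* [hpart xi] and [vpart i w xi] are the vectors X and Y such that
   xi = X^H + Y^V at w, see [lift_decomposition]. *)
Definition hpart (xi : 'rV[R]_m * 'rV[R]_m) : 'rV[R]_m := xi.1.

Definition vpart (i : chart M) (w xi : 'rV[R]_m * 'rV[R]_m) : 'rV[R]_m :=
  xi.2 + christoffel nabla i w.1 xi.1 w.2.

Variable a : R -> R.

Definition tangent_metric (i : chart M) (w xi eta : 'rV[R]_m * 'rV[R]_m) : R :=
  inner i w.1 (hpart xi) (hpart eta) +
  a (energy i w) *
    (inner i w.1 (vpart i w xi) (vpart i w eta)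
     + inner i w.1 (vpart i w xi) w.2 * inner i w.1 (vpart i w eta) w.2).

Definition Ja_horizontal (i : chart M) (w : 'rV[R]_m * 'rV[R]_m)
    (X : 'rV[R]_m) : 'rV[R]_m * 'rV[R]_m :=
  let t := energy i w in
  let r := fiber_radius t in
  (Num.sqrt (a t))^-1 *:
    (vlift X - (inner i w.1 X w.2 / (r * (1 + r))) *: vlift w.2).

Definition Ja_vertical (i : chart M) (w : 'rV[R]_m * 'rV[R]_m)
    (X : 'rV[R]_m) : 'rV[R]_m * 'rV[R]_m :=
  let t := energy i w in
  let r := fiber_radius t in
  - (Num.sqrt (a t) *:
      (hlift i w X + (inner i w.1 X w.2 / (1 + r)) *: hlift i w w.2)).

Definition Ja (i : chart M) (w xi : 'rV[R]_m * 'rV[R]_m)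
    : 'rV[R]_m * 'rV[R]_m :=
  Ja_horizontal i w (hpart xi) + Ja_vertical i w (vpart i w xi).

Definition Ja_integrable : Prop :=
  forall i (xi eta : 'rV[R]_m * 'rV[R]_m -> 'rV[R]_m * 'rV[R]_m),
    smooth_on (tregion i) xi -> smooth_on (tregion i) eta ->
  forall w, tregion i w -> nijenhuis (Ja i) xi eta w = 0.

Lemma lift_decomposition (i : chart M) (w xi : 'rV[R]_m * 'rV[R]_m) :
  xi = hlift i w (hpart xi) + vlift (vpart i w xi).
Proof.
case: xi => X Y; rewrite /hlift /vlift /vpart /hpart /=.
by congr pair; rewrite /= ?addr0 // addrCA addNr addr0.
Qed.

Lemma innerC i x X Y : region i x -> inner i x X Y = inner i x Y X.
Proof.
move=> ix; rewrite /inner /gram_form.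
have -> : (X *m gram g i x *m Y^T) 0 0 = (X *m gram g i x *m Y^T)^T 0 0.
  by rewrite [RHS]mxE.
by rewrite !trmx_mul trmxK gram_sym // mulmxA.
Qed.

Lemma innerDl i x b X X' Y :
  inner i x (b *: X + X') Y = b * inner i x X Y + inner i x X' Y.
Proof. by rewrite /inner /gram_form !mulmxDl -!scalemxAl !mxE. Qed.

Lemma inner_ge0 i x X : region i x -> 0 <= inner i x X X.
Proof.
move=> ix; have [->|X0] := eqVneq X 0; last exact/ltW/gram_pos.
by rewrite /inner /gram_form mul0mx mul0mx mxE.
Qed.

Lemma christoffel0l i x Y : region i x -> christoffel nabla i x 0 Y = 0.
Proof.
move=> ix; have := christoffel_linearl nabla ix (- 1) 0 0 Y.
by rewrite scaler0 addr0 scaleN1r addNr.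
Qed.

Lemma Ja_hlift i w X : region i w.1 ->
  Ja i w (hlift i w X) = Ja_horizontal i w X.
Proof.
move=> iw; rewrite /Ja /hpart /vpart /hlift /= addNr.
have -> : Ja_vertical i w 0 = 0; last by rewrite addr0.
rewrite /Ja_vertical /hlift christoffel0l // oppr0.
have -> : inner i w.1 0 w.2 = 0 by rewrite /inner /gram_form !mul0mx mxE.
by rewrite mul0r scale0r addr0 scaler0 oppr0.
Qed.

Lemma Ja_vlift i w X : region i w.1 -> Ja i w (vlift X) = Ja_vertical i w X.
Proof.
move=> iw; rewrite /Ja /hpart /vpart /vlift /= christoffel0l // addr0.
have -> : Ja_horizontal i w 0 = 0; last by rewrite add0r.
rewrite /Ja_horizontal.
have -> : inner i w.1 0 w.2 = 0 by rewrite /inner /gram_form !mul0mx mxE.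
by rewrite mul0r scale0r subr0 scaler0.
Qed.

Lemma hpart_Ja i w xi : hpart (Ja i w xi) =
  - Num.sqrt (a (energy i w)) *: ((inner i w.1 (vpart i w xi) w.2
       / (1 + fiber_radius (energy i w))) *: w.2 + vpart i w xi).
Proof.
rewrite /Ja /hpart /Ja_horizontal /Ja_vertical /=.
by rewrite !(scaler0, oppr0, subr0, add0r) scaleNr [_ *: w.2 + _]addrC.
Qed.

Lemma vpart_Ja i w xi : region i w.1 -> vpart i w (Ja i w xi) =
  (Num.sqrt (a (energy i w)))^-1 *: ((- (inner i w.1 (hpart xi) w.2
       / (fiber_radius (energy i w) * (1 + fiber_radius (energy i w))))) *: w.2
    + hpart xi).
Proof.
move=> iw; rewrite {1}/vpart -/(hpart (Ja i w xi)) hpart_Ja.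
have linZ b X Y : christoffel nabla i w.1 (b *: X) Y =
    b *: christoffel nabla i w.1 X Y.
  have := christoffel_linearl nabla iw b X 0 Y.
  by rewrite christoffel0l // !addr0.
rewrite linZ christoffel_linearl // /Ja /Ja_horizontal /Ja_vertical /=.
rewrite [X in _ + - (_ *: X) + _](_ : _ =
    - ((inner i w.1 (vpart i w xi) w.2 / (1 + fiber_radius (energy i w))) *:
         christoffel nabla i w.1 w.2 w.2
       + christoffel nabla i w.1 (vpart i w xi) w.2)); last first.
  by rewrite scalerN -opprD addrC.
rewrite scalerN opprK scaleNr -addrA subrr addr0; congr (_ *: _).
by rewrite scaleNr addrC.
Qed.

Lemma Ja_compatible i w xi eta : region i w.1 -> 0 < a (energy i w) ->
  tangent_metric i w (Ja i w xi) (Ja i w eta) = tangent_metric i w xi eta.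
Proof.
move=> iw a0; rewrite /tangent_metric !hpart_Ja !vpart_Ja //.
have innerZ b X Y : inner i w.1 (b *: X) Y = b * inner i w.1 X Y.
  by rewrite /inner /gram_form -!scalemxAl !mxE.
have innerZr b X Y : inner i w.1 X (b *: Y) = b * inner i w.1 X Y.
  by rewrite innerC // innerZ innerC.
have innerDr b X Y Z : inner i w.1 X (b *: Y + Z) =
    b * inner i w.1 X Y + inner i w.1 X Z.
  by rewrite innerC // innerDl ![inner _ _ _ X]innerC.
rewrite !(innerZ, innerZr, innerDr, innerDl).
rewrite ![inner i w.1 w.2 (vpart _ _ _)]innerC //.
rewrite ![inner i w.1 w.2 (hpart _)]innerC //.
set s := Num.sqrt _; set r := fiber_radius _.
have aE : a (energy i w) = s ^+ 2 by rewrite sqr_sqrtr // ltW.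
have s0 : s != 0 by rewrite gt_eqF // sqrtr_gt0.
have u0 := inner_ge0 w.2 iw.
have rE : inner i w.1 w.2 w.2 = r ^+ 2 - 1.
  rewrite /r /fiber_radius sqr_sqrtr /energy; first by field.
  by rewrite mulrA divff // mul1r addr_ge0.
have r0 : 0 < r by rewrite sqrtr_gt0 /energy mulrA divff // mul1r ltr_wpDr.
have r1 : 1 + r != 0 by rewrite gt_eqF // addr_gt0.
rewrite aE rE; field.
by rewrite s0 r1 gt_eqF.
Qed.

End Manifold.

Arguments gram {R m M} _ _ _.
Arguments christoffel {R m M} _ _ _ _ _.

(* Main.v *)
From HB Require Import structures.
Require Import Defs.
From mathcomp Require Import all_boot all_order all_algebra.
From mathcomp Require Import all_classical all_reals all_analysis.
From mathcomp Require Import ring lra.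
Set Implicit Arguments.
Unset Strict Implicit.
Unset Printing Implicit Defensive.
Import Order.TTheory GRing.Theory Num.Theory numFieldNormedType.Exports.
Local Open Scope classical_set_scope.
Local Open Scope ring_scope.

(** The Nijenhuis tensor is evaluated at (p, u) on the constant coordinate
    fields that coincide there with X^H and Y^H. Writing J_a X^H = (F_X)^V, the
    vertical part of N(X^H, Y^H) is [F_X, F_Y] + R(X, Y)u, where the bracket is
    that of vector fields on the vector space T_pM, so integrability gives the
    formula for R(X, Y)u with a factor depending on t only. Since R(X, Y)u is
    linear in u and m >= 2, this factor is invariant under t |-> b^2 t, hence a
    constant c on ]0, +oo[; this is the sectional curvature at every point, and
    Schur's lemma is not needed. As a function of r the equation for a becomes
    linear in 1/a, with solution 1/a = c (r^2 - 1) + k (1 + r)^2 e^(-2r);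
    positivity of 1/a at r = 1 gives k > 0, and as r tends to infinity it gives
    c >= 0. *)

(** * Derivatives of curves *)

Section Derivatives.
Context {R : realType}.

(** Both difference quotients are the same function of [h]. This is how the directional derivatives
    in Lie brackets on T(M) get computed from curves. *)
Lemma is_derive_line (V W : normedModType R) (f : V -> W) (x v : V) (d : W) :
  is_derive (0 : R) 1 (fun h => f (h *: v + x)) d -> is_derive x v f d.
Proof.
move=> [df fd]; apply: DeriveDef; first exact: (derivable1P _ _ _).2.
rewrite -fd /derive; set F := (X in lim (X @ _)).
set G := (X in _ = lim (X @ _)).
suff -> : F = G by [].
apply/funext => h; rewrite /F /G /=.
by rewrite addr0 scale0r add0r [_%:A]mulr1.
Qed.

Lemma is_derive_on_line (V W : normedModType R) (f : V -> W) (x v : V) :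
  differentiable f x ->
  is_derive (0 : R) 1 (fun h => f (h *: v + x)) ('D_v f x).
Proof.
move=> /(@diff_derivable _ _ _ _ _ v) df; apply: DeriveDef.
  exact: (derivable1P _ _ _).1.
rewrite /derive; set F := (X in lim (X @ _)).
set G := (X in _ = lim (X @ _)).
suff -> : F = G by [].
apply/funext => h; rewrite /F /G /=.
by rewrite addr0 scale0r add0r [_%:A]mulr1.
Qed.

Lemma is_derive1_cvg (W : normedModType R) (f : R -> W) (x : R) (d : W) :
  h^-1 *: (f (h + x) - f x) @[h --> 0^'] --> d -> is_derive x 1 f d.
Proof.
have -> : (fun h : R => h^-1 *: (f (h + x) - f x)) =
    (fun h => h^-1 *: ((f \o shift x) (h *: 1) - f x)).
  by apply/funext => h /=; rewrite [_%:A]mulr1.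
by move=> fd; apply: DeriveDef; [apply/cvg_ex; exists d|exact: cvg_lim fd].
Qed.

Lemma cvg_is_derive1 (W : normedModType R) (f : R -> W) (x : R) (d : W) :
  is_derive x 1 f d -> h^-1 *: (f (h + x) - f x) @[h --> 0^'] --> d.
Proof.
move=> [fx <-]; rewrite /derive.
have -> : (fun h : R => h^-1 *: (f (h + x) - f x)) =
    (fun h => h^-1 *: ((f \o shift x) (h *: 1) - f x)).
  by apply/funext => h /=; rewrite [_%:A]mulr1.
exact: fx.
Qed.

Lemma is_derive1_continuous (W : normedModType R) (f : R -> W) (x : R) (d : W) :
  is_derive x 1 f d -> f (h + x) @[h --> 0^'] --> f x.
Proof.
move=> [/derivable1_diffP/differentiable_continuous fx _].
by apply/continuous_withinNshiftx.
Qed.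

Lemma is_derive1_scale (W : normedModType R) (f : R -> R) (F : R -> W)
    (x df : R) (dF : W) : is_derive x 1 f df -> is_derive x 1 F dF ->
  is_derive x 1 (fun y => f y *: F y) (df *: F x + f x *: dF).
Proof.
move=> fx Fx; apply: is_derive1_cvg.
have -> : (fun h => h^-1 *: (f (h + x) *: F (h + x) - f x *: F x)) =
    (fun h => (h^-1 *: (f (h + x) - f x)) *: F (h + x)
       + f x *: (h^-1 *: (F (h + x) - F x))).
  apply/funext => h.
  rewrite [f x *: (_ *: _)]scalerA [f x * _]mulrC -!scalerA -scalerDr.
  by congr (_ *: _); rewrite scalerBl scalerBr addrA subrK.
apply: cvgD.
  exact: (cvgZ (cvg_is_derive1 fx) (is_derive1_continuous Fx)).
exact: (cvgZl_tmp (cvg_is_derive1 Fx)).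
Qed.

Lemma is_derive1_add (W : normedModType R) (f F : R -> W) (x : R) (df dF : W) :
  is_derive x 1 f df -> is_derive x 1 F dF ->
  is_derive x 1 (fun y => f y + F y) (df + dF).
Proof. by move=> fx Fx; exact: (is_deriveD fx Fx). Qed.

Lemma is_derive1_mul (f F : R -> R) (x df dF : R) :
  is_derive x 1 f df -> is_derive x 1 F dF ->
  is_derive x 1 (fun y => f y * F y) (df * F x + f x * dF).
Proof. exact: is_derive1_scale. Qed.

Lemma is_derive1_pair (V W : normedModType R) (f : R -> V) (F : R -> W) (x : R)
    (df : V) (dF : W) : is_derive x 1 f df -> is_derive x 1 F dF ->
  is_derive x 1 (fun y => (f y, F y)) (df, dF).
Proof.
move=> fx Fx; apply: is_derive1_cvg.
exact: (cvg_pair (cvg_is_derive1 fx) (cvg_is_derive1 Fx)).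
Qed.

(* One-sided differentiability of [b] on the ray suffices as [f] stays in it. *)
Lemma is_derive1_ray (b f : R -> R) (x d : R) :
  (\forall y \near x, 0 <= f y) ->
  cvg (ray_quotient b (f x) @ ray_nbhs (f x)) ->
  is_derive x 1 f d ->
  is_derive x 1 (fun y => b (f y)) (ray_derive b (f x) * d).
Proof.
move=> f0 bfx fd; apply: is_derive1_cvg.
(* The slope of [b] from [f x], completed by its limit at [f x]: the factorisation [bq] then also
   holds where [f] returns to the value [f x]. *)
pose q s := if s == f x then ray_derive b (f x) else ray_quotient b (f x) s.
have bq s : b s - b (f x) = q s * (s - f x).
  rewrite /q; case: eqP => [->|/eqP sx]; first by rewrite !subrr mulr0.
  by rewrite /ray_quotient divfK // subr_eq0.
have -> : (fun h => h^-1 *: (b (f (h + x)) - b (f x))) =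
    (fun h => q (f (h + x)) * (h^-1 *: (f (h + x) - f x))).
  by apply/funext => h; rewrite bq [LHS]mulrCA.
apply: cvgM; last exact: cvg_is_derive1.
have cf := is_derive1_continuous fd.
apply/cvgrPdist_lt => e e0.
have qe : \forall s \near within [set s | 0 <= s] (f x)^',
    `|ray_derive b (f x) - ray_quotient b (f x) s| < e.
  exact: (cvgrPdist_lt _ _).1 bfx _ e0.
move: qe; rewrite near_withinE /dnbhs near_withinE => qe.
have f0' : \forall h \near 0^', 0 <= f (h + x).
  exact: (is_derive1_continuous (is_derive_id x (1 : R))) _ f0.
have qe' := cf _ qe.
near=> h; rewrite /q; case: eqP => [_|/eqP fhx].
  by rewrite subrr normr0.
have : 0 <= f (h + x) by near: h.
have : f (h + x) != f x -> 0 <= f (h + x) ->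
    `|ray_derive b (f x) - ray_quotient b (f x) (f (h + x))| < e by near: h.
by move=> /(_ fhx).
Unshelve. all: by end_near. Qed.

End Derivatives.

Lemma smooth_on_cst (R : realType) (V W : normedModType R) (U : set V) (b : W) :
  smooth_on U (cst b).
Proof.
move=> k; elim: k b => [|k IH] b /=; first by move=> x _; exact: cst_continuous.
split=> [x _|v]; first exact: differentiable_cst.
rewrite (_ : (fun x => 'D_v (cst b) x) = cst 0); first exact: IH.
by apply/funext => x; rewrite derive_cst.
Qed.

(* The derivative of [B] does not contribute, since [F] vanishes at [0]. *)
Lemma is_derive1_linear0 (R : realType) (m : nat) (W : normedModType R)
    (B : R -> 'rV[R]_m -> W) (F : R -> 'rV[R]_m) (dF : 'rV[R]_m) :
  (\forall h \near (0 : R), linear (B h)) ->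
  (forall j, exists d, is_derive (0 : R) 1 (fun h => B h (delta_mx 0 j)) d) ->
  F 0 = 0 -> is_derive (0 : R) 1 F dF ->
  is_derive (0 : R) 1 (fun h => B h (F h)) (B 0 dF).
Proof.
move=> linB dB F0 dFP.
(* In the standard basis, [B h (F h)] is a sum of scalar functions times vector functions, and the
   product rule applies to each term. *)
have sumB h : linear (B h) -> forall v,
    B h v = \sum_(j < m) v 0 j *: B h (delta_mx 0 j).
  move=> lB v; pose lBm := GRing.isLinear.Build R 'rV[R]_m W _ (B h) lB.
  pose L : {linear 'rV[R]_m -> W} := HB.pack (B h) lBm.
  rewrite -[LHS]/(L v) {1}(row_sum_delta v) linear_sum.
  by apply: eq_bigr => j _; rewrite linearZ.
pose G j h := F h 0 j *: B h (delta_mx 0 j).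
have dG j : is_derive (0 : R) 1 (G j) (dF 0 j *: B 0 (delta_mx 0 j)).
  have [d dBj] := dB j.
  have dFj : is_derive (0 : R) 1 (fun h => F h 0 j) (dF 0 j).
    have [Fd <-] := dFP; split; first exact: ((derivable_mxP _ _ _).1 Fd).
    by rewrite derive_mx // mxE.
  by have := is_derive1_scale dFj dBj; rewrite F0 mxE scale0r addr0.
rewrite (sumB 0) ; last exact: nbhs_singleton linB.
apply: near_eq_is_derive (is_derive_sum dG).
near=> h; rewrite (sumB h); last by near: h.
by rewrite fct_sumE.
Unshelve. all: by end_near. Qed.

(** * Connection and metric along lines *)

Section TangentBundle.
Context {R : realType} {m : nat} {M : smooth_manifold R m}.
Variables (g : riemannian_metric M) (nabla : connection M) (a : R -> R).
Variable i : chart M.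

Implicit Types (x X Y Z W u : 'rV[R]_m).

Local Notation gamma := (christoffel nabla i).
Local Notation ip := (inner g i).

Lemma region_nbhs x : region i x -> \forall y \near x, region i y.
Proof. by move=> ix; apply: open_nbhs_nbhs; split => //; exact: coord_open. Qed.

Lemma region_line x Z : region i x ->
  \forall h \near (0 : R), region i (h *: Z + x).
Proof.
move=> ix; have : {for (0 : R), continuous (fun h : R => h *: Z + x)}.
  by apply: cvgD; [apply: cvgZr_tmp; exact: cvg_id|exact: cvg_cst].
by move=> cl; apply: cl; rewrite /= scale0r add0r; exact: region_nbhs.
Qed.

Lemma gammaDl x b X X' Y : region i x ->
  gamma x (b *: X + X') Y = b *: gamma x X Y + gamma x X' Y.
Proof. by move=> ix; exact: christoffel_linearl. Qed.

Lemma gammaDr x b X Y Y' : region i x ->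
  gamma x X (b *: Y + Y') = b *: gamma x X Y + gamma x X Y'.
Proof. by move=> ix; exact: christoffel_linearr. Qed.

Lemma gamma0r x X : region i x -> gamma x X 0 = 0.
Proof.
move=> ix; have := gammaDr (- 1) X 0 0 ix.
by rewrite scaler0 addr0 scaleN1r addNr.
Qed.

Lemma gammaNl x X Y : region i x -> gamma x (- X) Y = - gamma x X Y.
Proof.
move=> ix; have := gammaDl (- 1) X 0 Y ix.
by rewrite !addr0 christoffel0l // addr0 !scaleN1r.
Qed.

Lemma gammaNr x X Y : region i x -> gamma x X (- Y) = - gamma x X Y.
Proof.
move=> ix; have := gammaDr (- 1) X Y 0 ix.
by rewrite !addr0 gamma0r // addr0 !scaleN1r.
Qed.

Lemma ipDr x b X Y Y' : region i x ->
  ip x X (b *: Y + Y') = b * ip x X Y + ip x X Y'.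
Proof. by move=> ix; rewrite innerC // innerDl ![ip x _ X]innerC. Qed.

Lemma ip0l x Y : ip x 0 Y = 0.
Proof. by rewrite /inner /gram_form !mul0mx mxE. Qed.

Lemma ip_gt0 x X : region i x -> X != 0 -> 0 < ip x X X.
Proof. by move=> ix; exact: gram_pos. Qed.

Lemma cov_cst Y Z : cov nabla i (cst Y) (cst Z) = fun x => gamma x Y Z.
Proof. by apply/funext => x; rewrite /cov derive_cst add0r. Qed.

Lemma lie_bracket_cst (V : normedModType R) (X Y p : V) :
  lie_bracket (cst X) (cst Y) p = 0.
Proof. by rewrite /lie_bracket !derive_cst subrr. Qed.

Lemma curvatureE x X Y Z : region i x -> curvature nabla i x X Y Z =
  ('D_X (fun y => gamma y Y Z) x + gamma x X (gamma x Y Z))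
  - ('D_Y (fun y => gamma y X Z) x + gamma x Y (gamma x X Z)).
Proof.
move=> ix; rewrite /curvature /curvature_field !cov_cst {3}/cov lie_bracket_cst.
by rewrite derive_cst christoffel0l // !addr0 subr0.
Qed.

Lemma is_derive_gamma x X Y Z : region i x ->
  is_derive (0 : R) 1 (fun h => gamma (h *: Z + x) X Y)
    ('D_Z (fun y => gamma y X Y) x).
Proof.
move=> ix; apply: (@is_derive_on_line _ _ _ (fun y => gamma y X Y)).
by have [+ _] := christoffel_smooth nabla i X Y 1; apply.
Qed.

(** Linearity in the last slot splits the curve into [h] times one curve plus another, both with
    fixed vectors in the slots. *)
Lemma is_derive_gamma_line x Z u W X : region i x ->
  is_derive (0 : R) 1 (fun h => gamma (h *: Z + x) X (h *: W + u))
    ('D_Z (fun y => gamma y X u) x + gamma x X W).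
Proof.
move=> ix.
have := is_derive1_add (is_derive_gamma X u Z ix)
  (is_derive1_scale (is_derive_id (0 : R) (1 : R)) (is_derive_gamma X W Z ix)).
rewrite /= scale1r !scale0r addr0 add0r => dF; refine (near_eq_is_derive _ dF).
near=> h; rewrite gammaDr; first exact: addrC.
by near: h; exact: region_line.
Unshelve. all: by end_near. Qed.

Hypothesis LC : levi_civita g nabla.

Lemma is_derive_inner x X Y Z : region i x ->
  is_derive (0 : R) 1 (fun h => ip (h *: Z + x) X Y)
    (ip x (gamma x Z X) Y + ip x X (gamma x Z Y)).
Proof.
move=> ix.
have [_ /(_ i (cst Z) (cst X) (cst Y))] := LC.
move=> /(_ (smooth_on_cst _ _) (smooth_on_cst _ _) (smooth_on_cst _ _) x ix).
rewrite !cov_cst => <-.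
(* Metric compatibility only gives the value of ['D_Z]; that the derivative exists comes from the
   smoothness of the Gram matrix, entry by entry. *)
have dG : derivable (fun h : R => gram g i (h *: Z + x)) 0 1.
  have [+ _] := gram_smooth g i 1 => /(_ x ix).
  by move=> /(@diff_derivable _ _ _ _ _ Z) /derivable1P.
have dip : derivable (fun h : R => ip (h *: Z + x) X Y) 0 1.
  rewrite (_ : (fun h => _) = \sum_(k < m) \sum_(l < m)
      (fun h => X 0 l * gram g i (h *: Z + x) l k * Y 0 k)); last first.
    apply/funext => h; rewrite /inner /gram_form mxE fct_sumE.
    apply: eq_bigr => k _; rewrite fct_sumE !mxE mulr_suml.
    by apply: eq_bigr => l _.
  apply: derivable_sum => k; apply: derivable_sum => l.
  have dGlk := (derivable_mxP _ _ _).1 dG l k.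
  apply: (derivableM _ (derivable_cst _ _ _)).
  exact: (derivableM (derivable_cst _ _ _) dGlk).
have dD := @is_derive_line _ _ _ (fun y => ip y X Y) x Z _ (derivableP dip).
rewrite -[X in is_derive _ _ _ X]/('D_Z (fun y => ip y X Y) x).
rewrite (@derive_val _ _ _ _ _ _ _ dD).
exact: derivableP.
Qed.

Lemma is_derive_inner_line x Z u W X : region i x ->
  is_derive (0 : R) 1 (fun h => ip (h *: Z + x) X (h *: W + u))
    (ip x (gamma x Z X) u + ip x X (W + gamma x Z u)).
Proof.
move=> ix.
have := is_derive1_add (is_derive_inner X u Z ix)
  (is_derive1_mul (is_derive_id (0 : R) (1 : R)) (is_derive_inner X W Z ix)).
rewrite [_ + _ + _](_ : _ =
  ip x (gamma x Z X) u + ip x X (W + gamma x Z u)); last first.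
  rewrite -[W in RHS]scale1r ipDr //= scale0r !mul0r !mul1r add0r addr0.
  by rewrite -addrA; congr (_ + _); exact: addrC.
move=> dF; refine (near_eq_is_derive _ dF); near=> h.
rewrite ipDr; first exact: addrC.
by near: h; exact: region_line.
Unshelve. all: by end_near. Qed.

(** Only the vertical part [W + gamma x Z u] of the direction (Z, W) enters, so the energy is
    stationary along horizontal lifts. *)
Lemma is_derive_energy x Z u W : region i x ->
  is_derive (0 : R) 1 (fun h => energy g i (h *: Z + x, h *: W + u))
    (ip x (W + gamma x Z u) u).
Proof.
move=> ix.
have dW := is_derive1_mul (is_derive_id (0 : R) (1 : R))
  (is_derive_inner_line Z u W W ix).
have := is_derive1_mul (is_derive_cst (2^-1 : R) (0 : R) (1 : R))
  (is_derive1_add (is_derive_inner_line Z u W u ix) dW).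
rewrite [_ + _](_ : _ = ip x (W + gamma x Z u) u); last first.
  rewrite -[W in RHS]scale1r !innerDl //=.
  rewrite ?scale1r ?scale0r ?mul0r ?addr0 ?add0r ?mul1r.
  rewrite -[X in X + gamma _ _ _]scale1r ipDr // mul1r.
  rewrite [ip x u W]innerC // [ip x u (gamma _ _ _)]innerC //.
  by field.
move=> dF; refine (near_eq_is_derive _ dF); near=> h; rewrite /energy /=.
have ih : region i (h *: Z + x) by near: h; exact: region_line.
rewrite innerDl ![_ * (_ + _)]mulrC; congr (_ * _); exact: addrC.
Unshelve. all: by end_near. Qed.

End TangentBundle.

(** * The complex structure along lines *)

Section ComplexStructure.
Context {R : realType} {m : nat} {M : smooth_manifold R m}.
Variables (g : riemannian_metric M) (nabla : connection M) (a : R -> R).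
Variable i : chart M.
Implicit Types (x X Y Z W u : 'rV[R]_m).

Local Notation gamma := (christoffel nabla i).
Local Notation ip := (inner g i).

Hypothesis LC : levi_civita g nabla.
Hypothesis a_gt0 : forall t, 0 <= t -> 0 < a t.
Hypothesis a_smooth : ray_smooth a.

(* With these, J_a X^H = (alpha X - beta g(X, u) u)^V. *)
Definition alpha (t : R) : R := (Num.sqrt (a t))^-1.
Definition beta (t : R) : R :=
  alpha t / (fiber_radius t * (1 + fiber_radius t)).
(** The t-derivatives of [alpha] = a^(-1/2) and of [beta]; since dr/dt = 1/r, the derivative of r(1
    + r) is (1 + 2r)/r. *)
Definition dalpha (t : R) : R := - ray_derive a t / (2 * a t) * alpha t.
Definition dbeta (t : R) : R :=
  let r := fiber_radius t in
  dalpha t / (r * (1 + r)) - alpha t * ((1 + 2 * r) / r) / (r * (1 + r)) ^+ 2.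

Lemma fiber_radius_gt0 (t : R) : 0 <= t -> 0 < fiber_radius t.
Proof. by move=> t0; rewrite sqrtr_gt0; nra. Qed.

Lemma fiber_radius_sqr (t : R) : 0 <= t -> fiber_radius t ^+ 2 = 1 + 2 * t.
Proof. by move=> t0; rewrite sqr_sqrtr //; nra. Qed.

Lemma energy_ge0 x u : region i x -> 0 <= energy g i (x, u).
Proof. by move=> ix; rewrite mulr_ge0 //; exact: inner_ge0. Qed.

Section AlongCurve.
Variables (f : R -> R) (z t d : R).
Hypothesis f_ge0 : \forall y \near z, 0 <= f y.
Hypothesis f0 : f z = t.
Hypothesis df : is_derive z 1 f d.

Let t0 : 0 <= t. Proof. by rewrite -f0; exact: nbhs_singleton f_ge0. Qed.

(** The base value is a separate variable [t] with [f z = t] because the energy along a line starts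
    at [(0 *: Z + x, 0 *: W + u)], which has to be rewritten into (x, u). *)
Lemma is_derive_ray : is_derive z 1 (fun h => a (f h)) (ray_derive a t * d).
Proof.
have ca : cvg (ray_quotient a (f z) @ ray_nbhs (f z)).
  by rewrite f0; exact: (@a_smooth 0%N t t0).
by have := is_derive1_ray f_ge0 ca df; rewrite f0.
Qed.

Lemma is_derive_sqrt_a : is_derive z 1 (fun h => Num.sqrt (a (f h)))
  (ray_derive a t / (2 * Num.sqrt (a t)) * d).
Proof.
have dsq : is_derive (a (f z)) 1 Num.sqrt (2 * Num.sqrt (a (f z)))^-1.
  by apply: is_derive1_sqrt; rewrite f0; exact: a_gt0.
have := @is_derive1_comp _ Num.sqrt (fun h => a (f h)) z _ _ dsq is_derive_ray.
by rewrite f0 mulrCA mulrA.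
Qed.

Lemma is_derive_alpha :
  is_derive z 1 (fun h => alpha (f h)) (dalpha t * d).
Proof.
have a0 : 0 < a t by exact: a_gt0.
have s0 : Num.sqrt (a t) != 0 by rewrite gt_eqF // sqrtr_gt0.
have sf0 : Num.sqrt (a (f z)) != 0 by rewrite f0.
have := @is_deriveV _ (fun h => Num.sqrt (a (f h))) z _ 1 sf0 is_derive_sqrt_a.
rewrite f0 [X in is_derive _ _ _ X](_ : _ = dalpha t * d) //.
rewrite /GRing.scale /= /dalpha /alpha -[in 2 * a t](sqr_sqrtr (ltW a0)).
by field.
Qed.

Lemma is_derive_fiber_radius :
  is_derive z 1 (fun h => fiber_radius (f h)) (d / fiber_radius t).
Proof.
have d1 := is_derive1_add (is_derive_cst (1 : R) z (1 : R))
  (is_derive1_mul (is_derive_cst (2 : R) z (1 : R)) df).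
have r0 := fiber_radius_gt0 t0.
have dsq : is_derive (1 + 2 * f z) 1 Num.sqrt (2 * Num.sqrt (1 + 2 * f z))^-1.
  by apply: is_derive1_sqrt; rewrite f0 ltr_wpDr ?mulr_ge0.
have := @is_derive1_comp _ Num.sqrt (fun h => 1 + 2 * f h) z _ _ dsq d1.
rewrite f0 -/(fiber_radius t).
rewrite [X in is_derive _ _ _ X](_ : _ = d / fiber_radius t) //=.
by field; rewrite gt_eqF.
Qed.

Lemma is_derive_beta :
  is_derive z 1 (fun h => beta (f h)) (dbeta t * d).
Proof.
have r0 := fiber_radius_gt0 t0.
have dr := is_derive_fiber_radius.
have drr := is_derive1_mul dr
  (is_derive1_add (is_derive_cst (1 : R) z (1 : R)) dr).
have rr0 : fiber_radius (f z) * (1 + fiber_radius (f z)) != 0.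
  by rewrite f0; apply: lt0r_neq0; nra.
have := is_derive1_mul is_derive_alpha (@is_deriveV _ _ z _ 1 rr0 drr).
rewrite f0 [X in is_derive _ _ _ X](_ : _ = dbeta t * d) //=.
rewrite /dbeta /GRing.scale /=; field.
by apply/andP; split; apply: lt0r_neq0; nra.
Qed.

End AlongCurve.

(* For xi = X^H + V^V, the vertical part of J_a xi is [vfield x u X] and its
   horizontal part is [hfield x u V]. *)
Definition vfield x u X := alpha (energy g i (x, u)) *: X
  - (beta (energy g i (x, u)) * ip x X u) *: u.

Definition hfield x u V := (- Num.sqrt (a (energy g i (x, u)))) *:
  ((ip x V u / (1 + fiber_radius (energy g i (x, u)))) *: u + V).

(** A pair [(K, F - gamma x K u)] is the coordinate form of K^H + F^V; values and derivatives of J_a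
    are all kept in this shape. *)
Lemma JaE x u (xi : 'rV[R]_m * 'rV[R]_m) : region i x ->
  let V := vpart nabla i (x, u) xi in
  Ja g nabla a i (x, u) xi =
  (hfield x u V, vfield x u xi.1 - gamma x (hfield x u V) u).
Proof.
move=> ix V; set J := Ja _ _ _ _ _ _.
have J1 : J.1 = hfield x u V := hpart_Ja g nabla a i (x, u) xi.
have J2 : J.2 + gamma x J.1 u = _ := vpart_Ja g nabla a (w := (x, u)) xi ix.
rewrite [LHS]surjective_pairing J1; congr pair.
rewrite -[LHS](addrK (gamma x (hfield x u V) u)) -{1}J1 J2; congr (_ - _).
rewrite /= /vfield scalerDr scalerA [LHS]addrC.
rewrite -[X in _ = _ + X]scaleNr; congr (_ + _ *: _).
by rewrite mulrN mulrA; congr (- _); exact: mulrAC.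
Qed.

(* The derivative of [vfield x ^~ X] at [u] along [W], for fixed [x]. *)
Definition dvfield x u X W : 'rV[R]_m :=
  let t := energy g i (x, u) in
  (dalpha t * ip x W u) *: X
  - ((dbeta t * ip x W u * ip x X u + beta t * ip x X W) *: u
     + (beta t * ip x X u) *: W).

(** The value is recorded for vertical directions only. In other directions existence is enough:
    there [dF] enters the Nijenhuis tensor under a further J_a, which moves it to the horizontal
    part. *)
Lemma is_derive_vfield x u X Z W : region i x -> exists2 dF,
  is_derive (0 : R) 1 (fun h => vfield (h *: Z + x) (h *: W + u) X) dF &
  Z = 0 -> dF = dvfield x u X W.
Proof.
move=> ix; set t := energy g i (x, u).
have Ege0 : \forall y \near (0 : R), 0 <= energy g i (y *: Z + x, y *: W + u).
  by near=> y; apply: energy_ge0; near: y; exact: region_line.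
have E0 : energy g i (0 *: Z + x, 0 *: W + u) = t by rewrite !scale0r !add0r.
have dE := is_derive_energy LC Z u W ix.
have da := is_derive_alpha Ege0 E0 dE.
have db := is_derive_beta Ege0 E0 dE.
have did := is_derive1_add (is_derive1_scale (is_derive_id (0 : R) (1 : R))
  (is_derive_cst W (0 : R) (1 : R))) (is_derive_cst u (0 : R) (1 : R)).
have dip := is_derive_inner_line LC Z u W X ix.
have dv := is_derive1_add
  (is_derive1_scale da (is_derive_cst X (0 : R) (1 : R)))
  (is_deriveN (is_derive1_scale (is_derive1_mul db dip) did)).
eexists; first exact: dv.
move=> Z0; rewrite /dvfield /= E0 Z0 !christoffel0l // ip0l.
rewrite !(scale0r, add0r, addr0, scale1r, scaler0) -/t.
by [].
Unshelve. all: by end_near. Qed.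

(** The constant field that equals X^H at (x, u) does not stay horizontal; its vertical part along
    the line is differentiated here, and this is where the curvature comes from. *)
Lemma vpart_hlift_line x u X Z W : region i x ->
  is_derive (0 : R) 1
    (fun h => - gamma x X u + gamma (h *: Z + x) X (h *: W + u))
    ('D_Z (fun y => gamma y X u) x + gamma x X W).
Proof.
move=> ix.
have := is_derive1_add (is_derive_cst (- gamma x X u) (0 : R) (1 : R))
  (is_derive_gamma_line nabla Z u W X ix).
by rewrite add0r.
Qed.

Lemma hfield0 x u : hfield x u 0 = 0.
Proof. by rewrite /hfield ip0l mul0r scale0r addr0 scaler0. Qed.

(** [hfield] is linear in its last argument, which vanishes at 0, so the derivatives of the
    coefficients drop out. *)
Lemma is_derive_hfield x u Z W (V : R -> 'rV[R]_m) dV : region i x ->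
  V 0 = 0 -> is_derive (0 : R) 1 V dV ->
  is_derive (0 : R) 1 (fun h => hfield (h *: Z + x) (h *: W + u) (V h))
    (hfield x u dV).
Proof.
move=> ix V0 dVP; set t := energy g i (x, u).
have Ege0 : \forall y \near (0 : R), 0 <= energy g i (y *: Z + x, y *: W + u).
  by near=> y; apply: energy_ge0; near: y; exact: region_line.
have t0 : 0 <= t by exact: energy_ge0.
have E0 : energy g i (0 *: Z + x, 0 *: W + u) = t by rewrite !scale0r !add0r.
have dE := is_derive_energy LC Z u W ix.
have dsq := is_derive_sqrt_a Ege0 E0 dE.
have dr := is_derive1_add (is_derive_cst (1 : R) (0 : R) (1 : R))
  (is_derive_fiber_radius Ege0 E0 dE).
have r0 : 1 + fiber_radius (energy g i (0 *: Z + x, 0 *: W + u)) != 0.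
  by rewrite E0 lt0r_neq0 // addr_gt0 // fiber_radius_gt0.
have dri := @is_deriveV _ _ 0 _ 1 r0 dr.
have did := is_derive1_add (is_derive1_scale (is_derive_id (0 : R) (1 : R))
  (is_derive_cst W (0 : R) (1 : R))) (is_derive_cst u (0 : R) (1 : R)).
have dip : is_derive (0 : R) 1
    (fun h => ip (h *: Z + x) (V h) (h *: W + u)) (ip x dV u).
  have lin : \forall h \near (0 : R),
      linear (fun Y => ip (h *: Z + x) Y (h *: W + u)).
    by near=> h; move=> b X Y; rewrite innerDl.
  have dB j : exists d, is_derive (0 : R) 1
      (fun h => ip (h *: Z + x) (delta_mx 0 j) (h *: W + u)) d.
    by eexists; exact: (is_derive_inner_line LC Z u W (delta_mx 0 j) ix).
  have := is_derive1_linear0 lin dB V0 dVP.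
  by rewrite !scale0r !add0r.
have dns : is_derive (0 : R) 1
    (fun h => - Num.sqrt (a (energy g i (h *: Z + x, h *: W + u)))) _ :=
  is_deriveN dsq.
have dv := is_derive1_scale dns
  (is_derive1_add (is_derive1_scale (is_derive1_mul dip dri) did) dVP).
move: dv; rewrite /= E0 V0 !ip0l !scale0r !add0r.
rewrite !(mul0r, addr0, scale0r, scaler0, add0r).
by [].
Unshelve. all: by end_near. Qed.

(** At (x, u) the constant field is horizontal, so its image under J_a has horizontal part 0 there.
    The Christoffel correction is linear in that part and hence contributes only through its
    derivative [K]. *)
Lemma is_derive_Ja x u X Z W : region i x ->
  let K := hfield x u ('D_Z (fun y => gamma y X u) x + gamma x X W) in
  exists2 dF,
    is_derive (x, u) (Z, W) (fun q => Ja g nabla a i q (X, - gamma x X u))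
      (K, dF - gamma x K u) &
    Z = 0 -> dF = dvfield x u X W.
Proof.
move=> ix K; have [dF dFP dF0] := is_derive_vfield u X Z W ix.
exists dF => //; apply: is_derive_line.
pose V h := - gamma x X u + gamma (h *: Z + x) X (h *: W + u).
have V0 : V 0 = 0 by rewrite /V !scale0r !add0r addNr.
have dH := is_derive_hfield u Z W ix V0 (vpart_hlift_line u X Z W ix).
have dG : is_derive (0 : R) 1 (fun h => gamma (h *: Z + x)
    (hfield (h *: Z + x) (h *: W + u) (V h)) (h *: W + u)) (gamma x K u).
  have lin : \forall h \near (0 : R),
      linear (fun Y => gamma (h *: Z + x) Y (h *: W + u)).
    near=> h; move=> b Y Y'; rewrite gammaDl //.
    by near: h; exact: region_line.
  have dB j : exists d, is_derive (0 : R) 1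
      (fun h => gamma (h *: Z + x) (delta_mx 0 j) (h *: W + u)) d.
    by eexists; exact: (is_derive_gamma_line nabla Z u W (delta_mx 0 j) ix).
  have H0 : hfield (0 *: Z + x) (0 *: W + u) (V 0) = 0 by rewrite V0 hfield0.
  have := is_derive1_linear0 lin dB H0 dH.
  by rewrite !scale0r !add0r.
have dJ := is_derive1_pair dH (is_derive1_add dFP (is_deriveN dG)).
refine (near_eq_is_derive _ dJ); near=> h.
have ih : region i (h *: Z + x) by near: h; exact: region_line.
rewrite -[RHS]/(Ja g nabla a i (h *: Z + x, h *: W + u) _) JaE.
Unshelve. all: by end_near. Qed.

End ComplexStructure.

(** * The curvature formula *)

(** Constant fields commute, and a bracket of a constant field with another field is a single
    derivative of the latter, up to sign. *)
Lemma nijenhuis_cst (R : realType) (V : normedModType R) (J : V -> V -> V)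
    (xi eta p Jxi Jeta D1 D2 D3 D4 : V) : J p xi = Jxi -> J p eta = Jeta ->
  is_derive p Jxi (J ^~ eta) D1 -> is_derive p Jeta (J ^~ xi) D2 ->
  is_derive p eta (J ^~ xi) D3 -> is_derive p xi (J ^~ eta) D4 ->
  nijenhuis J (cst xi) (cst eta) p = D1 - D2 - J p (- D3) - J p D4.
Proof.
move=> <- <- [_ <-] [_ <-] [_ <-] [_ <-].
rewrite /nijenhuis lie_bracket_cst subr0 /lie_bracket.
by rewrite (derive_cst eta) (derive_cst xi) sub0r subr0.
Qed.

Section Curvature.
Context {R : realType} {m : nat} {M : smooth_manifold R m}.
Variables (g : riemannian_metric M) (nabla : connection M) (a : R -> R).
Variable i : chart M.
Implicit Types (x X Y Z W u : 'rV[R]_m).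

Local Notation gamma := (christoffel nabla i).
Local Notation ip := (inner g i).

Hypothesis LC : levi_civita g nabla.
Hypothesis a_gt0 : forall t, 0 <= t -> 0 < a t.
Hypothesis a_smooth : ray_smooth a.
Hypothesis J_integrable : Ja_integrable g nabla a.

Local Notation vf x u X := (vfield g a i x u X).
Local Notation dvf x u X W := (dvfield g a i x u X W).

Lemma Ja_horizontalE x u X : region i x ->
  Ja g nabla a i (x, u) (X, - gamma x X u) = (0, vf x u X).
Proof.
move=> ix; rewrite JaE // /vpart /= addNr hfield0 christoffel0l //.
by rewrite subr0.
Qed.

Lemma vpartB x u (xi eta : 'rV[R]_m * 'rV[R]_m) : region i x ->
  vpart nabla i (x, u) (xi - eta) =
  vpart nabla i (x, u) xi - vpart nabla i (x, u) eta.
Proof.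
move=> ix; rewrite /vpart /=.
have -> : xi.1 - eta.1 = 1 *: xi.1 + - eta.1 by rewrite scale1r.
by rewrite gammaDl // scale1r gammaNl // opprD addrACA.
Qed.

Lemma vpart_pair x u K F : vpart nabla i (x, u) (K, F - gamma x K u) = F.
Proof. by rewrite /vpart /= subrK. Qed.

Lemma vpart_JaE x u (xi : 'rV[R]_m * 'rV[R]_m) : region i x ->
  vpart nabla i (x, u) (Ja g nabla a i (x, u) xi) = vf x u xi.1.
Proof. by move=> ix; rewrite JaE // vpart_pair. Qed.

Lemma ip_sqr x u : region i x ->
  ip x u u = fiber_radius (energy g i (x, u)) ^+ 2 - 1.
Proof.
move=> ix; rewrite fiber_radius_sqr; last exact: energy_ge0.
by rewrite /energy /=; field.
Qed.

(** This is J_a^2 = -1 on vertical vectors; it rests on |u|^2 = r^2 - 1. *)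
Lemma vfield_hfield x u S : region i x -> vf x u (hfield g a i x u S) = - S.
Proof.
move=> ix; have t0 := energy_ge0 g u ix.
have r0 := fiber_radius_gt0 t0; have nE := ip_sqr u ix.
have s0 : 0 < Num.sqrt (a (energy g i (x, u))) by rewrite sqrtr_gt0 a_gt0.
rewrite /vfield /hfield; set t := energy _ _ _ in t0 r0 nE s0 *.
set s := Num.sqrt (a t) in s0 *; set r := fiber_radius t in r0 nE *.
have ipZ b Z : ip x (b *: Z) u = b * ip x Z u.
  by rewrite -[b *: Z]addr0 innerDl ip0l addr0.
rewrite ipZ innerDl nE /beta /alpha -/r -/s.
apply/rowP => k; rewrite !mxE; field.
by rewrite !lt0r_neq0 // addr_gt0.
Qed.

Lemma hfieldN x u S : hfield g a i x u (- S) = - hfield g a i x u S.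
Proof.
rewrite /hfield -[X in ip _ X]scaleN1r -[-1 *: S]addr0 innerDl ip0l addr0.
by rewrite -scalerN opprD; congr (_ *: (_ + _)); rewrite mulN1r mulNr scaleNr.
Qed.

(** The vertical part of J_a xi depends only on the horizontal part of xi, so [F3] and [F4]
    disappear, while [vfield_hfield] recovers [S3] and [S4] up to sign. *)
Lemma vpart_nijenhuis x u K1 F1 K2 F2 S3 F3 S4 F4 : region i x ->
  vpart nabla i (x, u) ((K1, F1 - gamma x K1 u) - (K2, F2 - gamma x K2 u)
    - Ja g nabla a i (x, u) (- (hfield g a i x u S3, F3))
    - Ja g nabla a i (x, u) (hfield g a i x u S4, F4)) = F1 - F2 - S3 + S4.
Proof.
move=> ix; rewrite vpartB // [X in _ - X = _]vpart_JaE //.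
rewrite vpartB // [X in _ - X - _ = _]vpart_JaE // vpartB // !vpart_pair /=.
by rewrite -hfieldN !vfield_hfield // !opprK.
Qed.

(* The right-hand side is - [F_X, F_Y] for F_X = [vfield x ^~ X] on T_xM. *)
Lemma curvature_vfield x u X Y : region i x ->
  curvature nabla i x X Y u =
  dvf x u X (vf x u Y) - dvf x u Y (vf x u X).
Proof.
move=> ix.
pose xi : 'rV[R]_m * 'rV[R]_m := (X, - gamma x X u).
pose eta : 'rV[R]_m * 'rV[R]_m := (Y, - gamma x Y u).
(* [D1] and [D2] are taken along J xi and J eta, which are vertical at (x, u), so the values are
   explicit; [D3] and [D4] are taken along eta and xi. *)
have [F1 D1 /(_ erefl) F1E] :=
  is_derive_Ja LC a_gt0 a_smooth u Y 0 (vf x u X) ix.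
have [F2 D2 /(_ erefl) F2E] :=
  is_derive_Ja LC a_gt0 a_smooth u X 0 (vf x u Y) ix.
have [F3 D3 _] := is_derive_Ja LC a_gt0 a_smooth u X Y (- gamma x Y u) ix.
have [F4 D4 _] := is_derive_Ja LC a_gt0 a_smooth u Y X (- gamma x X u) ix.
have N0 := J_integrable (smooth_on_cst (tregion i) xi)
  (smooth_on_cst (tregion i) eta) (w := (x, u)) ix.
have N := nijenhuis_cst (Ja_horizontalE u X ix) (Ja_horizontalE u Y ix)
  D1 D2 D3 D4.
have := etrans (congr1 (vpart nabla i (x, u)) (etrans (esym N0) N))
  (vpart_nijenhuis _ _ _ _ _ _ _ _ _ ix).
rewrite /vpart /= christoffel0l // addr0 !gammaNr // F1E F2E => {}N0.
(* In [N0] the two terms coming from [D4] and [D3] combine to R(X, Y)u in coordinates. *)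
rewrite curvatureE //; apply/eqP; rewrite -subr_eq0; apply/eqP.
rewrite [RHS]N0.
apply/rowP => k; rewrite !mxE; ring.
Qed.

(** The coefficient of u is symmetric in X and Y and cancels. As alpha - beta |u|^2 = alpha / r,
    what remains has the factor alpha alpha' / r + alpha^2 / (r (1 + r)). *)
Lemma curvature_formula x u X Y : region i x ->
  let t := energy g i (x, u) in
  let r := fiber_radius t in
  curvature nabla i x X Y u =
  ((2 * a t - (1 + r) * ray_derive a t) / (2 * a t ^+ 2 * r * (1 + r))) *:
    (ip x Y u *: X - ip x X u *: Y).
Proof.
move=> ix t r; rewrite curvature_vfield //.
have t0 : 0 <= t by exact: energy_ge0.
have r0 : 0 < r by exact: fiber_radius_gt0.
have nE : ip x u u = r ^+ 2 - 1 by exact: ip_sqr.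
have s0 : 0 < Num.sqrt (a t) by rewrite sqrtr_gt0 a_gt0.
have aE : a t = Num.sqrt (a t) ^+ 2 by rewrite sqr_sqrtr // ltW // a_gt0.
rewrite /dvfield /vfield -/t.
have ipB b c Z Z' V : ip x (b *: Z - c *: Z') V = b * ip x Z V - c * ip x Z' V.
  by rewrite innerDl -scaleNr -[- c *: Z']addr0 innerDl ip0l addr0 mulNr.
have ipBr b c Z Z' V : ip x V (b *: Z - c *: Z') = b * ip x V Z - c * ip x V Z'.
  by rewrite innerC // ipB ![ip x _ V]innerC.
rewrite !ipB !ipBr nE [ip x Y X]innerC // /dalpha /beta /alpha -/r aE.
(* Rewriting [a t] as a square has also changed the radicands; this restores them, leaving a
   rational identity in the root of [a t] and r. *)
rewrite !sqrtr_sqr !(gtr0_norm s0).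
apply/rowP => k; rewrite !mxE; field.
by rewrite !lt0r_neq0 // addr_gt0.
Qed.

End Curvature.

(** * The differential equation for a *)

Section Profile.
Context {R : realType}.
Variable a : R -> R.
Hypothesis a_gt0 : forall t, 0 <= t -> 0 < a t.
Hypothesis a_smooth : ray_smooth a.

Definition curvature_factor (t : R) : R :=
  let r := fiber_radius t in
  (2 * a t - (1 + r) * ray_derive a t) / (2 * a t ^+ 2 * r * (1 + r)).

Variable c : R.
Hypothesis a_ode : forall t, 0 < t -> curvature_factor t = c.

(* The constant k: solve 1/a = 2 c t + k (1 + r)^2 e^(-2r) for k. *)
Definition first_integral (t : R) : R :=
  ((a t)^-1 - 2 * c * t) * (expR (2 * fiber_radius t) /
    (1 + fiber_radius t) ^+ 2).

(* The substitution t = z^2 makes the derivative at the end point t = 0 vanish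
   and replaces the ray by the whole line. *)
Lemma is_derive_first_integral (y : R) :
  is_derive y 1 (fun z => first_integral (z ^+ 2)) 0.
Proof.
set t := y ^+ 2; have t0 : 0 <= t by exact: sqr_ge0.
have sq0 : \forall z \near y, 0 <= z ^+ 2 by near=> z; exact: sqr_ge0.
have dsq : is_derive y 1 (fun z : R => z ^+ 2) (2 * y).
  have := is_derive1_mul (is_derive_id y (1 : R)) (is_derive_id y (1 : R)).
  by rewrite /= mul1r mulr1 (_ : y + y = 2 * y) //; ring.
have at0 := a_gt0 t0; have r0 := fiber_radius_gt0 t0.
have r2 := fiber_radius_sqr t0.
have da := is_derive_ray a_smooth sq0 erefl dsq.
have dr := is_derive_fiber_radius sq0 erefl dsq.
have a0' : a (y ^+ 2) != 0 by rewrite gt_eqF.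
have dai := @is_deriveV _ _ y _ 1 a0' da.
have dct : is_derive y 1 (fun z => - (2 * c * z ^+ 2)) _ :=
  is_deriveN (is_derive1_mul (is_derive_cst (2 * c) y (1 : R)) dsq).
have db := is_derive1_add dai dct.
have d2r := is_derive1_mul (is_derive_cst (2 : R) y (1 : R)) dr.
have de := @is_derive1_comp _ expR (fun z => 2 * fiber_radius (z ^+ 2)) y _ _
  (is_derive_expR _) d2r.
have d1r := is_derive1_add (is_derive_cst (1 : R) y (1 : R)) dr.
have dp := is_derive1_mul d1r d1r.
have p0 : (1 + fiber_radius (y ^+ 2)) * (1 + fiber_radius (y ^+ 2)) != 0.
  by rewrite -expr2 expf_neq0 // lt0r_neq0 // addr_gt0.
have := is_derive1_mul db (is_derive1_mul de (@is_deriveV _ _ y _ 1 p0 dp)).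
rewrite [X in is_derive _ _ _ X](_ : _ = 0) //=.
rewrite -/t /GRing.scale /=.
(* The equation for a is only given for t > 0; at y = 0 the factor 2y of the chain rule annihilates
   every term. *)
have [y0|y0] := eqVneq y 0; first by rewrite y0; ring.
have tE : t = (fiber_radius t ^+ 2 - 1) / 2 by rewrite r2; field.
(* For b = 1/a the equation reads db/dr + 2r/(1 + r) b = 2 c r^2, with particular solution 2ct = c
   (r^2 - 1) and integrating factor e^(2r)/(1 + r)^2. *)
have := a_ode (t := t); rewrite exprn_even_gt0 // y0 => /(_ isT).
rewrite /curvature_factor -/t [X in - (2 * c * X)]tE.
set r := fiber_radius t in r0 *; set A := a t in at0 *.
set E := expR _; set D := ray_derive a t => <-.
by field; rewrite !lt0r_neq0 // addr_gt0.
Unshelve. all: by end_near. Qed.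

Lemma first_integral_cst (t : R) : 0 <= t ->
  first_integral t = first_integral 0.
Proof.
move=> t0; have := is_derive_0_is_cst (Num.sqrt t) 0 is_derive_first_integral.
by rewrite sqr_sqrtr // expr0n.
Qed.

Lemma profile_solution : 0 <= c /\ exists2 k : R, 0 < k &
  forall t, 0 <= t ->
    let r := fiber_radius t in
    a t = expR (2 * r) / ((1 + r) * (c * expR (2 * r) * (r - 1) + k * (1 + r))).
Proof.
pose k := first_integral 0.
have k0 : 0 < k.
  have r0 := fiber_radius_gt0 (lexx (0 : R)).
  rewrite /k /first_integral mulr0 subr0 mulr_gt0 ?invr_gt0 ?a_gt0 //.
  by rewrite divr_gt0 ?expR_gt0 // exprn_gt0 // addr_gt0.
have aV t : 0 <= t -> (a t)^-1 = 2 * c * t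
    + k * ((1 + fiber_radius t) ^+ 2 / expR (2 * fiber_radius t)).
  move=> t0; rewrite /k -(first_integral_cst t0) /first_integral.
  have r0 := fiber_radius_gt0 t0; have E0 := expR_gt0 (2 * fiber_radius t).
  have A0 := a_gt0 t0.
  set A := a t in A0 *; set E := expR _ in E0 *.
  set r := fiber_radius t in r0 *.
  by field; rewrite !lt0r_neq0 // addr_gt0.
split.
  rewrite leNgt; apply/negP => c0.
  (* Chosen so that 2ct = -k. Since 1 + r <= e^r, the other term of 1/a is at most k, so 1/a would
     not be positive; an explicit point replaces the limit. *)
  pose t := k / (- 2 * c).
  have d0 : 0 < - 2 * c by nra.
  have t0 : 0 < t by rewrite divr_gt0.
  have := aV t (ltW t0).
  have -> : 2 * c * t = - k by rewrite /t; field; rewrite lt_eqF.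
  have at0 : 0 < (a t)^-1 by rewrite invr_gt0 a_gt0 // ltW.
  have r0 := fiber_radius_gt0 (ltW t0).
  have e1 := expR_ge1Dx (fiber_radius t).
  have E2 : expR (2 * fiber_radius t) = expR (fiber_radius t) ^+ 2.
    by rewrite -expRM_natl.
  have : (1 + fiber_radius t) ^+ 2 / expR (2 * fiber_radius t) <= 1.
    rewrite ler_pdivrMr ?expR_gt0 // mul1r E2.
    by rewrite lerXn2r // nnegrE ?expR_ge0 // addr_ge0 // ltW.
  by move=> q1 aE; nra.
exists k => // t t0 /=.
have r0 := fiber_radius_gt0 t0; have E0 := expR_gt0 (2 * fiber_radius t).
have tE : t = (fiber_radius t ^+ 2 - 1) / 2.
  by rewrite fiber_radius_sqr //; field.
apply: invr_inj; rewrite invf_div (aV t t0) [X in 2 * c * X]tE.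
by field; rewrite lt0r_neq0.
Qed.

End Profile.

(** * Constant curvature *)

Section ConstantCurvature.
Context {R : realType} {m : nat} {M : smooth_manifold R m}.
Variables (g : riemannian_metric M) (nabla : connection M) (i : chart M).
Implicit Types (x X Y Z : 'rV[R]_m) (b : R).

Local Notation gamma := (christoffel nabla i).
Local Notation ip := (inner g i).

Lemma ipZl x b X Y : ip x (b *: X) Y = b * ip x X Y.
Proof. by rewrite -[b *: X]addr0 innerDl ip0l addr0. Qed.

Lemma ipZr x b X Y : region i x -> ip x X (b *: Y) = b * ip x X Y.
Proof. by move=> ix; rewrite innerC // ipZl innerC. Qed.

Lemma ipBl x X X' Y : ip x (X - X') Y = ip x X Y - ip x X' Y.
Proof.
by rewrite -[X in X - _]scale1r innerDl mul1r -scaleN1r ipZl mulN1r.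
Qed.

Lemma gammaZr x b X Y : region i x -> gamma x X (b *: Y) = b *: gamma x X Y.
Proof.
by move=> ix; rewrite -[b *: Y]addr0 gammaDr // gamma0r // addr0.
Qed.

Lemma curvatureZ x b X Y Z : region i x ->
  curvature nabla i x X Y (b *: Z) = b *: curvature nabla i x X Y Z.
Proof.
move=> ix; rewrite !curvatureE //.
have DZ V W : 'D_V (fun y => gamma y W (b *: Z)) x =
    b *: 'D_V (fun y => gamma y W Z) x.
  have [/(_ x ix) dG _] := christoffel_smooth nabla i W Z 1.
  rewrite -(deriveZ b (@diff_derivable _ _ _ _ _ V dG)); apply: near_eq_derive.
  near=> y; rewrite gammaZr //; near: y; exact: region_nbhs.
by rewrite !DZ !gammaZr // !scalerBr !scalerDr.
Unshelve. all: by end_near. Qed.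

Lemma energyZ x b X : region i x ->
  energy g i (x, b *: X) = b ^+ 2 * energy g i (x, X).
Proof. by move=> ix; rewrite /energy /= ipZl ipZr //; ring. Qed.

Variable phi : R -> R.
Hypothesis curvature_phi : forall x X Y Z, region i x ->
  curvature nabla i x X Y Z =
  phi (energy g i (x, Z)) *: (ip x Y Z *: X - ip x X Z *: Y).

(* Linearity of R(X, Y) forces [phi] to be invariant under scaling. *)
Lemma factor_constant x (s t : R) : (2 <= m)%N -> region i x ->
  0 < s -> 0 < t -> phi s = phi t.
Proof.
move=> m2 ix.
pose i0 : 'I_m := Ordinal (ltnW m2 : (0 < m)%N).
pose i1 : 'I_m := Ordinal (m2 : (1 < m)%N).
pose e0 : 'rV[R]_m := delta_mx 0 i0; pose e1 : 'rV[R]_m := delta_mx 0 i1.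
have n0 : 0 < ip x e0 e0.
  apply: ip_gt0 => //; apply/eqP => /matrixP/(_ 0 i0).
  by rewrite !mxE !eqxx => /eqP; rewrite oner_eq0.
have E0 : 0 < energy g i (x, e0) by rewrite mulr_gt0.
suff to_e0 r : 0 < r -> phi r = phi (energy g i (x, e0)).
  by move=> s0 t0; rewrite !to_e0.
move=> r0; set E := energy g i (x, e0) in E0 *.
(* The scaling that takes [e0] to a vector of energy [r]. *)
pose b := Num.sqrt (r / E).
have b0 : 0 < b by rewrite sqrtr_gt0 divr_gt0.
have rE : r = energy g i (x, b *: e0).
  by rewrite energyZ // sqr_sqrtr ?divfK ?lt0r_neq0 // ltW // divr_gt0.
have := curvatureZ b e1 e0 e0 ix; rewrite !curvature_phi // -rE -/E.
(* The component along [e1] of R(e1, e0)(b e0) = b R(e1, e0)e0: the term in [e0] has no such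
   component, and b |e0|^2 can be cancelled. *)
move=> /matrixP/(_ 0 i1); rewrite !mxE !ipZr // !eqxx /=.
rewrite mulr1 !mulr0 !subr0 mulrCA => /(mulfI (lt0r_neq0 b0)).
by rewrite !mulr1 => /(mulIf (lt0r_neq0 n0)).
Qed.

Lemma sectional_curvature_factor (c : R) x X Y : region i x ->
  (forall t, 0 < t -> phi t = c) -> free [:: X; Y] ->
  sectional_curvature g nabla i x X Y = c.
Proof.
move=> ix phic XY.
have Y0 : Y != 0.
  by move: XY; rewrite free_cons seq1_free => /andP[].
have YY0 := ip_gt0 g ix Y0.
(* This is |Y|^2 times the part of X orthogonal to Y. Its squared norm is |Y|^2 times the Gram
   determinant of X and Y, which is therefore positive. *)
have V0 : ip x Y Y *: X - ip x X Y *: Y != 0.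
  move: XY; rewrite free_cons span_seq1 => /andP[+ _]; apply: contraNneq.
  move=> /eqP; rewrite subr_eq0 => /eqP XE; apply/vlineP.
  exists ((ip x Y Y)^-1 * ip x X Y).
  by rewrite -scalerA -XE scalerA mulVf ?scale1r // lt0r_neq0.
have D0 : 0 < ip x X X * ip x Y Y - ip x X Y ^+ 2.
  have := ip_gt0 g ix V0; rewrite ipBl !ipZl ![ip x _ (_ - _)]innerC //.
  rewrite !ipBl !ipZl [ip x Y X]innerC // => VV0.
  by rewrite -(pmulr_rgt0 _ YY0); move: VV0; congr (0 < _); ring.
rewrite /sectional_curvature curvature_phi // phic; last by rewrite mulr_gt0.
rewrite ipZl ipBl !ipZl [ip x Y X]innerC // -expr2 [ip x Y Y * _]mulrC.
by rewrite mulfK // lt0r_neq0.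
Qed.

End ConstantCurvature.

Theorem mainTheorem5 (R : realType) (m : nat) (M : smooth_manifold R m)
    (g : riemannian_metric M) (nabla : connection M) (a : R -> R) :
  (2 <= m)%N ->
  levi_civita g nabla ->
  (forall t, 0 <= t -> 0 < a t) ->
  ray_smooth a ->
  Ja_integrable g nabla a ->
  (forall (i : chart M) (x u X Y : 'rV[R]_m), region i x ->
     let t := energy g i (x, u) in
     let r := fiber_radius t in
     curvature nabla i x X Y u =
     ((2 * a t - (1 + r) * ray_derive a t)
        / (2 * a t ^+ 2 * r * (1 + r))) *:
     (inner g i x Y u *: X - inner g i x X u *: Y)) /\
  (exists c k : R,
     [/\ constant_sectional_curvature g nabla c,
         0 <= c,
         0 < k &
         forall t, 0 <= t ->
           let r := fiber_radius t in
           a t = expR (2 * r)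
                 / ((1 + r) * (c * expR (2 * r) * (r - 1) + k * (1 + r)))]).
Proof.
move=> m2 LC a_gt0 a_smooth JI.
have RE i x u X Y (ix : region i x) :=
  curvature_formula LC a_gt0 a_smooth JI u X Y ix.
split; first exact: RE.
have REphi i x X Y Z : region i x -> curvature nabla i x X Y Z =
    curvature_factor a (energy g i (x, Z)) *:
      (inner g i x Y Z *: X - inner g i x X Z *: Y).
  exact: RE.
have [p _] := space_nonempty M; have [i ip] := dom_cover p.
have ix : region i (Defs.coord i p) by exists p.
(* Any positive argument would do. The factor involves only [a], so a single point of M settles its
   constancy for every chart. *)
pose c := curvature_factor a 1.
have phic t : 0 < t -> curvature_factor a t = c.
  by move=> t0; exact: (factor_constant (REphi i) m2 ix).
have [c0 [k k0 aE]] := profile_solution a_gt0 a_smooth phic.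
exists c, k; split=> // j y jy X Y XY.
exact: (sectional_curvature_factor (REphi j)).
Qed.
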